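(* Let $p$ be a rational prime that splits in $\mathbb{Z}[i]$ as $p=\mathcal{P}\overline{\mathcal{P}}$, and let $I\in\{\mathcal{P},\overline{\mathcal{P}}\}$. Then $\mathbb{H}^3/\Gamma_1(I)$ contains no closed embedded totally geodesic surface. The same holds for $I=\langle 1+i\rangle$.
   Context: $\Gamma_1=\mathrm{PSL}(2,\mathbb{Z}[i])$, and for an ideal $I\subset\mathbb{Z}[i]$, $\Gamma_1(I)=\ker(\Gamma_1\to\mathrm{PSL}(2,\mathbb{Z}[i]/I))$ is the principal congruence subgroup. A ''surface'' means a quotient of $\mathbb{H}^2$ by a discrete group of isometries, possibly with torsion or orientation-reversing elements. For a finite-index subgroup $\Gamma<\Gamma_1$, totally geodesic surfaces in $\mathbb{H}^3/\Gamma$ correspond to $\Gamma$-orbits of circles/lines $\mathcal{C}$ with equation $a|z|^2+Bz+\bar B\bar z+c=0$, $a,c\in\mathbb{Z}$, $B\in\mathbb{Z}[i]$, $|B|^2-ac>0$; the surface is the image of the hyperbolic plane $H_{\mathcal{C}}$ bounded by $\mathcal{C}$, it is embedded if for all $\gamma\in\Gamma$, $\gamma H_{\mathcal{C}}=H_{\mathcal{C}}$ or $\gamma H_{\mathcal{C}}\cap H_{\mathcal{C}}=\emptyset$, and closed if compact. *)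

(* Defs.v *)
From HB Require Import structures.
From mathcomp Require Import all_boot all_order all_algebra.
From mathcomp Require Import complex.
From mathcomp Require Import reals.
Set Implicit Arguments. Unset Strict Implicit. Unset Printing Implicit Defensive.
Import Order.TTheory GRing.Theory Num.Theory.
Local Open Scope ring_scope.
Local Open Scope complex_scope.

Section Bianchi.
Variable R : realType.

Definition sqn (z : R[i]) : R := complex.Re z ^+ 2 + complex.Im z ^+ 2.

Definition gaussian (z : R[i]) : Prop :=
  exists x y : int, z = (x%:~R : R) +i* (y%:~R : R).

Definition gdvd (pi w : R[i]) : Prop :=
  exists2 q, gaussian q & w = pi * q.

Record mat2 := Mat2 { ma : R[i]; mb : R[i]; mc : R[i]; md : R[i] }.

Definition SL2Zi (g : mat2) : Prop :=
  [/\ gaussian (ma g), gaussian (mb g), gaussian (mc g), gaussian (md g)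
    & ma g * md g - mb g * mc g = 1].

(* Gamma_1(I) for I = (pi): the kernel of PSL(2,Z[i]) -> PSL(2,Z[i]/I),
   represented by its preimage in SL(2,Z[i]): matrices congruent to +-1 mod I
   (+-g induce the same isometry of H^3). *)
Definition Gamma1 (pi : R[i]) (g : mat2) : Prop :=
  SL2Zi g /\
  exists e : R[i], (e = 1 \/ e = -1) /\
    [/\ gdvd pi (ma g - e), gdvd pi (mb g), gdvd pi (mc g) & gdvd pi (md g - e)].

(* points of H^3 = C x R_{>0} (upper half-space model) *)
Definition pt := (R[i] * R)%type.

(* the standard (Poincare extension) action of (a b; c d) in SL(2,C) on H^3:
   (z,t) |-> ( ((az+b) conj(cz+d) + a conj(c) t^2) / D , t / D ),
   D = |cz+d|^2 + |c|^2 t^2. *)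
Definition act (g : mat2) (x : pt) : pt :=
  let: (z, t) := x in
  let: D := sqn (mc g * z + md g) + sqn (mc g) * t ^+ 2 in
  (((ma g * z + mb g) * conjc (mc g * z + md g) + ma g * conjc (mc g) * (t ^+ 2)%:C)
      * (D^-1)%:C,
   t / D).

(* the hyperbolic plane H_C bounded by the circle/line
   C : a|z|^2 + Bz + conj(B) conj(z) + c = 0, namely the hemisphere/vertical
   half-plane  a(|z|^2 + t^2) + Bz + conj(Bz) + c = 0, t > 0. *)
Definition plane (a : int) (B : R[i]) (c : int) (x : pt) : Prop :=
  0 < x.2 /\
  (a%:~R : R) * (sqn x.1 + x.2 ^+ 2) + 2 * complex.Re (B * x.1) + (c%:~R : R) = 0.

Definition admissible (a : int) (B : R[i]) (c : int) : Prop :=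
  gaussian B /\ 0 < sqn B - (a * c)%:~R.

Definition img (g : mat2) (H : pt -> Prop) (y : pt) : Prop :=
  exists2 x, H x & act g x = y.

Definition preserves (g : mat2) (H : pt -> Prop) : Prop :=
  forall y, img g H y <-> H y.

Definition disjoint_img (g : mat2) (H : pt -> Prop) : Prop :=
  forall y, ~ (img g H y /\ H y).

Definition embedded (G : mat2 -> Prop) (H : pt -> Prop) : Prop :=
  forall g, G g -> preserves g H \/ disjoint_img g H.

(* the surface H_C / Stab_G(H_C) is compact: there is a compact region
   K = {|z| <= r, eps <= t <= r} of H^3 such that every point of H_C is
   Stab_G(H_C)-equivalent to a point of K. *)
Definition closed_surface (G : mat2 -> Prop) (H : pt -> Prop) : Prop :=
  exists r eps : R, 0 < eps /\
    forall x, H x -> exists2 g, G g /\ preserves g H &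
      let: (z', t') := act g x in sqn z' <= r ^+ 2 /\ eps <= t' <= r.

Definition has_closed_embedded_tg_surface (G : mat2 -> Prop) : Prop :=
  exists (a : int) (B : R[i]) (c : int),
    admissible a B c /\ embedded G (plane a B c) /\ closed_surface G (plane a B c).

End Bianchi.

(* Main.v *)
(** The planes of H^3 are the integral Hermitian forms h = (a, B, c) of
    discriminant D = |B|^2 - ac > 0, the points are the matrices X in GL_2(C),
    up to scalars and right multiplication by U(2), and X lies on the plane of h
    iff tr (X^* h X) = 0.

    A closed surface comes from an anisotropic h, so that a <> 0 throughout its
    orbit and D is not a square.  A hemisphere a(|z|^2 + t^2) + ... = 0 has
    radius sqrt D / |a|; it crosses its translate by w <> 0 when |w| is less than
    its diameter, so embeddedness gives 4 D <= |w|^2 a^2 for each translation w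
    realised modulo the stabilizer of h.  Once 2 D <= a^2 holds on an SL_2(Z[i])-orbit,
    reducing B modulo a gives |c| < |a|, and swapping a and c is an infinite descent.

    For I = (1+i), w = 1+i is enough.  For a split prime one gets w = 1: if p does
    not divide D, the stabilizer of h contains unipotents modulo pi^m.  Indeed, a
    solution X^2 - D a^2 Z^2 = 1 of Pell's equation yields a stabilizing matrix
    for each Gaussian mu with |mu| = |Z|, with lower left entry a^2 mu and upper
    right entry D conj(mu) - conj(B)^2 mu; moving all the p-power of Z = p^n Z1 to
    one side, mu = pi^(2n) Z1, makes it congruent to a nontrivial unipotent.
    If p divides D, an isogeny of degree pi carries h to a form of
    discriminant D / p, at the cost of raising the level from pi^m to pi^(m+1). *)
Require Import Defs.
From HB Require Import structures.
From mathcomp Require Import all_boot all_order all_algebra.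
From mathcomp Require Import complex.
From mathcomp Require Import reals.
From mathcomp Require Import zify ring lra.
Set Implicit Arguments. Unset Strict Implicit. Unset Printing Implicit Defensive.
Import Order.TTheory GRing.Theory Num.Theory.
Local Open Scope ring_scope.
Local Open Scope complex_scope.

(** * Pell's equation *)

(* One step along the river of Conway's topograph of the indefinite form
   a u^2 + 2 b u v + c v^2: the river is periodic, and a period is an automorph. *)
Definition river (s : int * int * int) : int * int * int :=
  let: (a, b, c) := s in
  if 0 < a + 2 * b + c then (a + 2 * b + c, b + c, c)
  else (a, a + b, a + 2 * b + c).

Definition on_river (D : int) (s : int * int * int) : Prop :=
  let: (a, b, c) := s in [/\ 0 < a, c < 0 & b * b - a * c = D].

(** The new value a + 2b + c cannot vanish: the discriminant would then be the square (a + b)^2. *)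
Lemma river_stable (D : int) s : (forall d : int, d * d <> D) ->
  on_river D s -> on_river D (river s).
Proof.
case: s => [[a b] c] nsq [a0 c0 hD] /=.
have : a + 2 * b + c <> 0.
  move=> e0; apply: (nsq (a + b)).
  by rewrite -[LHS]subr0 -(mulr0 a) -e0 -hD; ring.
by case: ifP => h ne; split; rewrite -?hD; try lia; ring.
Qed.

(** The two branches are told apart by the sign of a - 2b + c on the image: it is the old a > 0 in
    the first and the old c < 0 in the second. *)
Lemma river_inj (D : int) s t :
  on_river D s -> on_river D t -> river s = river t -> s = t.
Proof.
case: s t => [[a b] c] [[a' b'] c'] [a0 c0 _] [a0' c0' _] /=.
by case: ifP => h; case: ifP => h' [] e1 e2 e3; (repeat congr pair); lia.
Qed.

(** As a > 0 > c, both b^2 and -ac are nonnegative with sum D, which bounds all three coefficients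
    by |D|. *)
Lemma on_river_finite (D : int) : exists L : seq (int * int * int),
  forall s, on_river D s -> s \in L.
Proof.
pose r := [seq k%:Z - `|D| | k <- iota 0 (2 * absz D).+1].
have mem_r (x : int) : `|x| <= `|D| -> x \in r.
  move=> hx; apply/mapP; exists (absz (x + `|D|)); last by lia.
  by rewrite mem_iota; lia.
exists [seq (u, z) | u <- [seq (x, y) | x <- r, y <- r], z <- r].
case=> [[a b] c] [a0 c0 hD].
have hac : a * c <= - a /\ a * c <= c by nia.
have bD : `|b| <= b * b by nia.
apply: allpairs_f; first apply: allpairs_f; apply: mem_r; nia.
Qed.

Lemma iter_on_river (D : int) s n : (forall d : int, d * d <> D) ->
  on_river D s -> on_river D (iter n river s).
Proof. by move=> nsq hs; elim: n => // n IH; apply: river_stable. Qed.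

(** Pigeonhole gives a repetition, and injectivity of the step cancels the preperiod. *)
Lemma river_returns (D : int) s : (forall d : int, d * d <> D) ->
  on_river D s -> exists2 n, (0 < n)%N & iter n river s = s.
Proof.
move=> nsq hs; have [L memL] := on_river_finite D.
have : ~~ uniq (traject river s (size L).+1).
  apply/negP => /uniq_leq_size le; have := le L.
  rewrite size_traject ltnn => H; apply: notF; apply: H => x /trajectP [i _ ->].
  exact/memL/iter_on_river.
case/(uniqPn s) => i [j [ij]]; rewrite size_traject => jL.
rewrite !nth_traject // ?(ltn_trans ij) // => e.
exists (j - i)%N; first by rewrite subn_gt0.
have {ij jL} : iter i river (iter (j - i) river s) = iter i river s.
  by rewrite -iterD subnKC // ltnW.
elim: i {e} (j - i)%N => // i IH k /= /(@river_inj D) e.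
by apply: IH; apply: e; rewrite -?iterD; apply: iter_on_river.
Qed.

Lemma pell (D : int) : 0 < D -> (forall d : int, d * d <> D) ->
  exists x z : int, z <> 0 /\ x * x - D * (z * z) = 1.
Proof.
move=> D0 nsq.
(* The nth form is u^2 - D v^2 in the basis (x, z), (y, w) of nonnegative vectors; the growth of the
   entry sum prevents a return to the standard basis. *)
have walk n : exists x y z w : int,
  [/\ 1 <= x, 0 <= y, 0 <= z & 1 <= w] /\ n%:Z + 2 <= x + y + z + w /\
  iter n river (1, 0, - D) = (x * x - D * (z * z), x * y - D * (z * w), y * y - D * (w * w)).
  elim: n => [|n [x [y [z [w [[x1 y0 z0 w1] [hn /= ->]]]]]]].
    by exists 1, 0, 0, 1; split=> //; split=> //=; (repeat congr pair); ring.
  rewrite /river; case: ifP => _.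
    exists (x + y), y, (z + w), w; split; first by split; lia.
    by split; [lia | (repeat congr pair); ring].
  exists x, (x + y), z, (z + w); split; first by split; lia.
  by split; [lia | (repeat congr pair); ring].
have [|n n0] := @river_returns D (1, 0, - D) nsq; first by split => //; lia.
have [x [y [z [w [[x1 y0 z0 w1] [hn ->]]]]]] := walk n.
case=> e1 e2 e3; exists x, z; split=> // z0'; subst z.
have x_1 : x = 1 by nia.
have y_0 : y = 0 by move: e2; rewrite x_1; lia.
have : D * (w * w - 1) = 0 by rewrite y_0 in e3; lia.
have : 0 < D * (w * w - 1) by apply: mulr_gt0 => //; nia.
lia.
Qed.

(** * Planes and points of H^3 as 2 x 2 matrices *)

Section Conj.
Variable R : realType.
Local Notation K := R[i].
Implicit Types (z w : K) (x y : R).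

Lemma conjcD z w : conjc (z + w) = conjc z + conjc w. Proof. exact: rmorphD. Qed.
Lemma conjcN z : conjc (- z) = - conjc z. Proof. exact: rmorphN. Qed.
Lemma conjcM z w : conjc (z * w) = conjc z * conjc w. Proof. exact: rmorphM. Qed.
Lemma conjcX z n : conjc (z ^+ n) = conjc z ^+ n. Proof. exact: rmorphXn. Qed.
Lemma conjc_int (m : int) : conjc (m%:~R : K) = m%:~R. Proof. exact: rmorph_int. Qed.
Definition conjcE :=
  (conjcD, conjcN, conjcM, conjcX, conjcK, conjc0, conjc1, conjc_nat, conjc_int,
   conjc_inv, @conjc_real R).

Lemma realCD x y : (x + y)%:C = x%:C + y%:C. Proof. exact: rmorphD. Qed.
Lemma realCN x : (- x)%:C = - x%:C. Proof. exact: rmorphN. Qed.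
Lemma realCM x y : (x * y)%:C = x%:C * y%:C. Proof. exact: rmorphM. Qed.
Lemma realCX x n : (x ^+ n)%:C = x%:C ^+ n. Proof. exact: rmorphXn. Qed.
Lemma realCV x : (x^-1)%:C = x%:C^-1. Proof. exact: fmorphV. Qed.
Lemma realC_int (m : int) : (m%:~R : R)%:C = m%:~R. Proof. exact: rmorph_int. Qed.
Lemma realC_nat (m : nat) : (m%:R : R)%:C = m%:R. Proof. exact: rmorph_nat. Qed.

Lemma sqnC z : (sqn z)%:C = z * conjc z.
Proof. by rewrite -sqr_normc -add_Re2_Im2. Qed.

Lemma sqn_ge0 z : 0 <= sqn z.
Proof. by rewrite addr_ge0 // sqr_ge0. Qed.

Lemma sqn_gt0 z : z != 0 -> 0 < sqn z.
Proof.
case: z => x y; rewrite eq_complex negb_and /sqn /= => /orP [] h.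
  by rewrite ltr_wpDr ?sqr_ge0 // exprn_even_gt0.
by rewrite ltr_wpDl ?sqr_ge0 // exprn_even_gt0.
Qed.

Lemma sqnM z w : sqn (z * w) = sqn z * sqn w.
Proof. by apply: complexI; rewrite realCM !sqnC conjcM mulrACA. Qed.
End Conj.

Section Mat2.
Variable R : realType.
Local Notation K := R[i].
Local Notation M := (mat2 R).
Implicit Types (g h A X : M) (k : K).

Definition mul2 g h : M :=
  Mat2 (ma g * ma h + mb g * mc h) (ma g * mb h + mb g * md h)
       (mc g * ma h + md g * mc h) (mc g * mb h + md g * md h).
Definition scal2 k : M := Mat2 k 0 0 k.
Definition star2 g : M :=
  Mat2 (conjc (ma g)) (conjc (mc g)) (conjc (mb g)) (conjc (md g)).
Definition det2 g : K := ma g * md g - mb g * mc g.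
Definition adj2 g : M := Mat2 (md g) (- mb g) (- mc g) (ma g).
Definition gaussian2 g : Prop :=
  [/\ gaussian (ma g), gaussian (mb g), gaussian (mc g) & gaussian (md g)].

Local Infix "**" := mul2 (at level 40, left associativity).

Lemma mul2A g h A : g ** (h ** A) = g ** h ** A.
Proof. by case: g h A => [????] [????] [????]; congr Mat2 => /=; ring. Qed.

Lemma mul1m g : scal2 1 ** g = g.
Proof. by case: g => [????]; congr Mat2 => /=; ring. Qed.

Lemma mulm1 g : g ** scal2 1 = g.
Proof. by case: g => [????]; congr Mat2 => /=; ring. Qed.

Lemma scal2C k g : scal2 k ** g = g ** scal2 k.
Proof. by case: g => [????]; congr Mat2 => /=; ring. Qed.

Lemma det2M g h : det2 (g ** h) = det2 g * det2 h.
Proof. by case: g h => [????] [????]; rewrite /det2 /=; ring. Qed.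

Lemma star2M g h : star2 (g ** h) = star2 h ** star2 g.
Proof.
case: g h => [????] [????]; congr Mat2 => /=; rewrite !conjcE; ring.
Qed.

Lemma det2_star g : det2 (star2 g) = conjc (det2 g).
Proof. by case: g => [????]; rewrite /det2 /= !conjcE; ring. Qed.

Lemma mul2_adj g : g ** adj2 g = scal2 (det2 g).
Proof. by case: g => [????]; congr Mat2; rewrite /det2 /=; ring. Qed.

Lemma adj2_mul g : adj2 g ** g = scal2 (det2 g).
Proof. by case: g => [????]; congr Mat2; rewrite /det2 /=; ring. Qed.

Definition pair2 h X : K := ma (star2 X ** h ** X) + md (star2 X ** h ** X).
End Mat2.

Local Infix "**" := mul2 (at level 40, left associativity).

Section Points.
Variable R : realType.
Local Notation K := R[i].
Local Notation M := (mat2 R).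

(** [B] sits below the diagonal so that the trace against the matrix (|z|^2 + t^2, z; conj z, 1) of
    a point is the equation of the plane. *)
Definition form (a : int) (B : K) (c : int) : M := Mat2 a%:~R (conjc B) B c%:~R.

Definition n2 (X : M) : R := sqn (mc X) + sqn (md X).

(* [X X^* / n2 X] is the matrix [(|z|^2 + t^2, z; conj z, 1)] of the point [(z, t)]. *)
Definition pt2 (X : M) : pt R :=
  ((ma X * conjc (mc X) + mb X * conjc (md X)) * (n2 X)^-1%:C,
   Num.sqrt (sqn (det2 X)) / n2 X).

Lemma n2_gt0 (X : M) : det2 X != 0 -> 0 < n2 X.
Proof.
move=> d0; have [c0|c0] := eqVneq (mc X) 0; last first.
  by rewrite ltr_wpDr ?sqn_ge0 ?sqn_gt0.
rewrite ltr_wpDl ?sqn_ge0 ?sqn_gt0 //; apply: contraNneq d0 => d0.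
by rewrite /det2 c0 d0 !mulr0 subrr.
Qed.

Lemma n2C (X : M) : (n2 X)%:C = mc X * conjc (mc X) + md X * conjc (md X).
Proof. by rewrite realCD !sqnC. Qed.

Lemma pt2_z (X : M) :
  (pt2 X).1 = (ma X * conjc (mc X) + mb X * conjc (md X)) / (n2 X)%:C.
Proof. by rewrite -realCV. Qed.

Lemma pt2_t2 (X : M) :
  ((pt2 X).2 ^+ 2)%:C = det2 X * conjc (det2 X) / (n2 X)%:C ^+ 2.
Proof. by rewrite expr_div_n sqr_sqrtr ?sqn_ge0 // realCM sqnC realCV realCX. Qed.

(** The plane equation at [pt2 X], multiplied by [n2 X], is the trace of X^* h X. *)
Lemma plane_pt2 (a : int) (B : K) (c : int) (X : M) : det2 X != 0 ->
  plane a B c (pt2 X) <-> pair2 (form a B c) X = 0.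
Proof.
move=> d0; have n0 := n2_gt0 d0.
have nC0 : (n2 X)%:C != 0 by rewrite fmorph_eq0 gt_eqF.
have t0 : 0 < (pt2 X).2 by rewrite divr_gt0 // sqrtr_gt0 sqn_gt0.
set e : R := a%:~R * (sqn (pt2 X).1 + (pt2 X).2 ^+ 2)
        + 2 * complex.Re (B * (pt2 X).1) + c%:~R.
have eC : e%:C * (n2 X)%:C = pair2 (form a B c) X.
  rewrite /e realCD (realCD (_ * _)) (realCM a%:~R) (realCD (sqn _)) sqnC pt2_t2.
  rewrite (realCM 2) !realC_int realC_nat.
  rewrite -addcJ pt2_z !conjcE; move: nC0; rewrite n2C.
  case: X {d0 n0 t0 e} => x1 x2 x3 x4; rewrite /det2 /pair2 /= ?conjcE => nC0.
  by field.
split=> [[_ he]|e0]; last split=> //.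
  by rewrite -eC -[e]/(_ + _) he mul0r.
by apply: (@complexI R); apply: (mulIf nC0); rewrite mul0r -e0 -eC.
Qed.

Lemma act_pt2 (g X : M) : det2 g = 1 -> det2 X != 0 -> act g (pt2 X) = pt2 (g ** X).
Proof.
move=> g1 d0; have n0 := n2_gt0 d0.
have n'0 : 0 < n2 (g ** X) by apply: n2_gt0; rewrite det2M g1 mul1r.
have nC0 : (n2 X)%:C != 0 by rewrite fmorph_eq0 gt_eqF.
have n'C0 : (n2 (g ** X))%:C != 0 by rewrite fmorph_eq0 gt_eqF.
rewrite [pt2 X]surjective_pairing /act.
set D := sqn _ + _.
have eD : D = n2 (g ** X) / n2 X.
  apply: complexI; rewrite /D realCM realCV realCD realCM  !sqnC pt2_t2 pt2_z !conjcE.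
  move: nC0; rewrite !n2C !conjcE; clear.
  case: g X => [a b c d] [x1 x2 x3 x4]; rewrite /det2 /= ?conjcE => nC0.
  by field.
rewrite eD [RHS]surjective_pairing; congr pair.
  rewrite pt2_t2 !pt2_z realCV (realCM (n2 _)) realCV !conjcE.
  move: nC0 n'C0; rewrite !n2C !conjcE; clear.
  case: g X => [a b c d] [x1 x2 x3 x4]; rewrite /det2 /= ?conjcE => nC0 nC0'.
  by field; rewrite nC0 nC0'.
rewrite /= det2M g1 mul1r invf_div mulrA divfK // gt_eqF //.
Qed.

End Points.

(** * Embeddedness in terms of matrices, and crossing hemispheres *)

Section Separation.
Variable R : realType.
Local Notation K := R[i].
Local Notation M := (mat2 R).
Implicit Types (h g A X tau sigma : M).

Definition separated h tau : Prop :=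
  (forall X, det2 X != 0 -> pair2 h X = 0 -> pair2 h (tau ** X) = 0) \/
  (forall X, det2 X != 0 -> pair2 h X = 0 -> pair2 h (tau ** X) <> 0).

Definition emb (nu : K) h : Prop := forall tau, Gamma1 nu tau -> separated h tau.

Lemma SL2Zi_det g : SL2Zi g -> det2 g = 1.
Proof. by case. Qed.

Lemma embedded_emb (nu : K) (a : int) (B : K) (c : int) :
  embedded (Gamma1 nu) (plane a B c) -> emb nu (form a B c).
Proof.
move=> E tau Gt; have dt := SL2Zi_det (proj1 Gt).
have dtX X : det2 X != 0 -> det2 (tau ** X) != 0 by rewrite det2M dt mul1r.
have imgP X : det2 X != 0 -> pair2 (form a B c) X = 0 ->
    img tau (plane a B c) (pt2 (tau ** X)).
  by move=> d0 hX; exists (pt2 X); [apply/plane_pt2 | rewrite act_pt2].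
case: (E _ Gt) => [P|P]; [left|right] => X d0 hX.
  by apply/plane_pt2; [exact: dtX|]; apply/P/imgP.
move=> hX'; apply: (P (pt2 (tau ** X))); split; first exact: imgP.
by apply/plane_pt2 => //; exact: dtX.
Qed.

Lemma congruence_transport A h h' (l : K) X :
  star2 A ** h ** A = scal2 l ** h' ->
  star2 (A ** X) ** h ** (A ** X) = scal2 l ** (star2 X ** h' ** X).
Proof.
move=> e; rewrite star2M -!mul2A (mul2A h) (mul2A (star2 A)) (mul2A (star2 A) h) e.
by rewrite !mul2A scal2C.
Qed.

Lemma pair2_transport A h h' (l : K) X :
  star2 A ** h ** A = scal2 l ** h' -> pair2 h (A ** X) = l * pair2 h' X.
Proof.
move=> e; rewrite /pair2 (congruence_transport _ e).
by case: (_ ** X) => ???? /=; ring.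
Qed.

(** The map X -> A X carries the plane of h' to that of h and intertwines tau' with tau. *)
Lemma separated_transport A h h' (l : K) tau tau' :
  star2 A ** h ** A = scal2 l ** h' -> l != 0 -> det2 A != 0 ->
  tau ** A = A ** tau' -> separated h tau -> separated h' tau'.
Proof.
move=> e l0 dA eA.
have dAX X : det2 X != 0 -> det2 (A ** X) != 0 by move=> dX; rewrite det2M mulf_neq0.
have p X : pair2 h (A ** X) = l * pair2 h' X := pair2_transport X e.
have p' X : pair2 h (tau ** (A ** X)) = l * pair2 h' (tau' ** X).
  by rewrite mul2A eA -mul2A p.
case=> S; [left|right] => X /dAX dX hX.
  by apply: (mulfI l0); rewrite mulr0 -p'; apply: S; rewrite // p hX mulr0.
by move=> hX'; apply: (S _ dX); rewrite ?p ?p' ?hX ?hX' mulr0.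
Qed.

Lemma emb_transport A h h' (l nu nu' : K) :
  star2 A ** h ** A = scal2 l ** h' -> l != 0 -> det2 A != 0 ->
  (forall tau', Gamma1 nu' tau' -> exists2 tau, Gamma1 nu tau & tau ** A = A ** tau') ->
  emb nu h -> emb nu' h'.
Proof.
move=> e l0 dA tr E tau' /tr [tau Gt eA].
exact: separated_transport e l0 dA eA (E _ Gt).
Qed.

(** The upper left entry of A^* h A is the value of h at the first column of A, so this says that h
    has no nonzero isotropic Gaussian vector. *)
Definition anisotropic h : Prop :=
  forall A, gaussian2 A -> det2 A != 0 -> ma (star2 A ** h ** A) != 0.

Definition transl (w : K) : M := Mat2 1 w 0 1.

Lemma mul2_surj sigma Y : det2 sigma != 0 -> exists X, sigma ** X = Y.
Proof.
move=> d0; exists (adj2 sigma ** (scal2 (det2 sigma)^-1 ** Y)).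
rewrite mul2A mul2_adj mul2A -[RHS]mul1m; congr (_ ** _).
by congr Mat2 => /=; rewrite ?mulr0 ?mul0r ?addr0 ?add0r ?divff.
Qed.

(** Represents the point (z, t) when t > 0. *)
Definition upper (z : K) (t : R) : M := Mat2 t%:C z 0 1.

Lemma pair2_upper h z t :
  pair2 h (upper z t) =
  ma h * (z * conjc z + t%:C ^+ 2) + mb h * conjc z + mc h * z + md h.
Proof.
have E u v w : pair2 h (Mat2 u z v w) = ma h * (conjc u * u + z * conjc z)
    + mb h * (conjc u * v + conjc z * w) + mc h * (conjc v * u + conjc w * z)
    + md h * (conjc v * v + conjc w * w).
  by rewrite /pair2 /=; ring.
by rewrite E !conjcE; ring.
Qed.

Lemma form_upper a B c z t :
  pair2 (form a B c) (upper z t) =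
  a%:~R * (z * conjc z + t%:C ^+ 2) + conjc B * conjc z + B * z + c%:~R :> K.
Proof. exact: pair2_upper. Qed.

Lemma det2_upper z t : 0 < t -> det2 (upper z t) != 0.
Proof. by move=> t0; rewrite /det2 /= mulr1 mulr0 subr0 fmorph_eq0 gt_eqF. Qed.

(* The two hemispheres meet above the midpoint of their centers. *)
Lemma crossing (a : int) (B : K) (c : int) (w : K) sigma :
  a != 0 -> 0 < sqn B - (a * c)%:~R -> w != 0 ->
  sqn w * a%:~R ^+ 2 < 4 * (sqn B - (a * c)%:~R) ->
  det2 sigma != 0 -> star2 sigma ** form a B c ** sigma = form a B c ->
  ~ separated (form a B c) (transl w ** sigma).
Proof.
set D := sqn B - _ => a0 D0 w0 hw ds es.
have aR0 : (a%:~R : R) != 0 by rewrite intr_eq0.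
have aC0 : (a%:~R : K) != 0 by rewrite intr_eq0.
have a2 : 0 < (a%:~R : R) ^+ 2 by rewrite exprn_even_gt0.
have DC : D%:C = B * conjc B - a%:~R * c%:~R.
  by rewrite /D realCD realCN realC_int sqnC intrM.
(* sigma preserves the form, so every point of the plane is the image under sigma of some point of
   it. *)
have lift Y : pair2 (form a B c) Y = 0 -> det2 Y != 0 ->
    exists X, [/\ det2 X != 0, pair2 (form a B c) X = 0 & sigma ** X = Y].
  move=> hY dY; have [X eX] := mul2_surj Y ds; exists X; split=> //.
    by apply: contraNneq dY => d0; rewrite -eX det2M d0 mulr0.
  have e1 : star2 sigma ** form a B c ** sigma = scal2 1 ** form a B c.
    by rewrite mul1m.
  by rewrite -[LHS]mul1r -(pair2_transport _ e1) eX.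
have tr (z : K) (t : R) : transl w ** upper z t = upper (z + w) t.
  by congr Mat2 => /=; ring.
have [z0 [ez0 cz0]] : exists z0 : K,
    z0 = - conjc B / a%:~R /\ conjc z0 = - B / a%:~R.
  by exists (- conjc B / a%:~R); rewrite !conjcE.
case=> S.
  (* The apex of the hemisphere, moved horizontally by w, leaves the hemisphere, so the first
     alternative fails. *)
  pose t := Num.sqrt (D / a%:~R ^+ 2).
  have t0 : 0 < t by rewrite sqrtr_gt0 divr_gt0.
  have tC : t%:C ^+ 2 = (B * conjc B - a%:~R * c%:~R) / a%:~R ^+ 2.
    by rewrite -realCX sqr_sqrtr ?ltW ?divr_gt0 // realCM DC realCV realCX realC_int.
  have [||X [dX hX eX]] := lift (upper z0 t).
  - by rewrite form_upper tC ?conjcE cz0 ez0; field.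
  - exact: det2_upper.
  have := S _ dX hX; rewrite -mul2A eX tr form_upper tC ?conjcE cz0.
  rewrite (_ : _ + _ = a%:~R * (w * conjc w)); last by rewrite ez0; field.
  move/eqP; rewrite !mulf_eq0 (negPf aC0) conjc_eq0 orbb /=.
  by rewrite (negPf w0).
(* The point over z0 - w/2 goes to the one over z0 + w/2 at the same height; for this t both lie on
   the hemisphere, against the second alternative. *)
pose t := Num.sqrt (D / a%:~R ^+ 2 - sqn w / 4).
have t2 : 0 < D / a%:~R ^+ 2 - sqn w / 4.
  by rewrite subr_gt0 ltr_pdivlMr // mulrAC ltr_pdivrMr // [D * _]mulrC.
have t0 : 0 < t by rewrite sqrtr_gt0.
have tC : t%:C ^+ 2 =
    (B * conjc B - a%:~R * c%:~R) / a%:~R ^+ 2 - w * conjc w / 4.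
  rewrite -realCX sqr_sqrtr ?ltW // realCD realCN (realCM D) (realCM (sqn w)) sqnC DC.
  by rewrite !realCV realCX realC_int realC_nat.
have [||X [dX hX eX]] := lift (upper (z0 - w / 2) t).
- by rewrite form_upper tC ?conjcE cz0 ez0; field.
- exact: det2_upper.
apply: (S _ dX hX); rewrite -mul2A eX tr form_upper tC ?conjcE cz0.
by rewrite ez0; field.
Qed.
End Separation.

(** * Gaussian integers and cusps *)

Section Gaussian.
Variable R : realType.
Local Notation K := R[i].

Lemma gaussian_int (m : int) : gaussian (m%:~R : K).
Proof. by exists m, 0; rewrite -realC_int. Qed.

Lemma gaussianD (z w : K) : gaussian z -> gaussian w -> gaussian (z + w).
Proof. by move=> [x [y ->]] [u [v ->]]; exists (x + u), (y + v); simpc; rewrite !intrD. Qed.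

Lemma gaussianN (z : K) : gaussian z -> gaussian (- z).
Proof. by move=> [x [y ->]]; exists (- x), (- y); simpc; rewrite !intrN. Qed.

Lemma gaussianM (z w : K) : gaussian z -> gaussian w -> gaussian (z * w).
Proof.
move=> [x [y ->]] [u [v ->]]; exists (x * u - y * v), (x * v + y * u).
by simpc; rewrite !(intrD, intrN, intrM).
Qed.

Lemma gaussianJ (z : K) : gaussian z -> gaussian (conjc z).
Proof. by move=> [x [y ->]]; exists x, (- y); simpc; rewrite intrN. Qed.

Lemma gaussianX (z : K) n : gaussian z -> gaussian (z ^+ n).
Proof.
by move=> gz; elim: n => [|n IH]; rewrite ?exprS; [exact: (gaussian_int 1) | exact: gaussianM].
Qed.

Lemma gaussian0 : gaussian (0 : K). Proof. exact: (gaussian_int 0). Qed.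
Lemma gaussian1 : gaussian (1 : K). Proof. exact: (gaussian_int 1). Qed.
End Gaussian.

#[local] Hint Resolve gaussian_int gaussian0 gaussian1 gaussianD gaussianN gaussianM gaussianJ
  gaussianX : core.

Section Cusps.
Variable R : realType.
Local Notation K := R[i].
Local Notation M := (mat2 R).

Lemma gaussian2M (g h : M) : gaussian2 g -> gaussian2 h -> gaussian2 (g ** h).
Proof. by move=> [????] [????]; split => /=; auto. Qed.

Lemma gaussian_sqn_ge1 (z : K) : gaussian z -> z != 0 -> 1 <= sqn z.
Proof.
move=> [x [y ez]] /sqn_gt0; rewrite {}ez /sqn /= !expr2 -!intrM -intrD.
by rewrite ltr0z ler1z gtz0_ge1.
Qed.

Lemma pt2_height (P : M) z (t : R) : 0 < t ->
  (pt2 (P ** upper z t)).2 =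
  Num.sqrt (sqn (det2 P)) * t / (sqn (mc P) * t ^+ 2 + sqn (mc P * z + md P)).
Proof.
move=> t0; rewrite /= det2M sqnM sqrtrM ?sqn_ge0 //; congr (_ * _ / _).
  rewrite /det2 /upper /sqn /= !(mulr0, mul0r, mulr1, mul1r, subr0, addr0, oppr0).
  by rewrite expr0n addr0 sqrtr_sqr gtr0_norm.
rewrite /n2 /= mulr0 addr0 sqnM mulr1; congr (_ * _ + _).
by rewrite /sqn /= expr0n addr0.
Qed.

(* If the first column of A is isotropic, A maps a vertical plane onto the given
   one; going up along it, every SL_2(Z[i])-translate of the image is very
   high or very low. *)
Lemma closed_anisotropic (nu : K) (a : int) (B : K) (c : int) :
  0 < sqn B - (a * c)%:~R ->
  closed_surface (Gamma1 nu) (plane a B c) -> anisotropic (form a B c).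
Proof.
set D := sqn B - _ => D0 [r [eps [e0 cpt]]] A gA dA; apply/eqP => iso.
pose h' := star2 A ** form a B c ** A.
have dh : det2 h' != 0.
  rewrite !det2M det2_star !mulf_neq0 ?conjc_eq0 //.
  have -> : det2 (form a B c) = - D%:C.
    by rewrite /det2 /= /D realCD realCN realC_int sqnC intrM; ring.
  by rewrite oppr_eq0 fmorph_eq0 gt_eqF.
have sh : star2 h' = h'.
  rewrite /h' !star2M -mul2A; congr (_ ** (_ ** _)).
    by rewrite /star2 /= !conjcE.
  by case: (A) => ????; rewrite /star2 /= !conjcK.
have eb : mb h' = conjc (mc h') by rewrite -{1}sh.
have ed : conjc (md h') = md h' by rewrite -{2}sh.
have B0 : mc h' != 0.
  by apply: contraNneq dh => B0; rewrite /det2 iso B0 mul0r mulr0 subrr.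
(* The upper left entry of h' vanishes, so its plane is vertical; every point over this z lies on
   it, whatever its height. *)
pose z := - md h' / (2 * mc h').
pose d := Num.sqrt (sqn (det2 A)).
have d0 : 0 < d by rewrite sqrtr_gt0 sqn_gt0.
(* The height exceeds d / eps and |r| d, the two thresholds met below. *)
pose t := d / eps + `|r| * d + 1.
have de0 : 0 <= d / eps by rewrite divr_ge0 // ltW.
have rd0 : 0 <= `|r| * d by rewrite mulr_ge0 // ltW.
have t0 : 0 < t by rewrite ltr_wpDl ?addr_ge0.
have dX : det2 (A ** upper z t) != 0 by rewrite det2M mulf_neq0 ?det2_upper.
have hX : plane a B c (pt2 (A ** upper z t)).
  apply/plane_pt2 => //; rewrite (@pair2_transport _ _ _ h' 1) ?mul1m //.
  rewrite mul1r pair2_upper iso eb mul0r add0r -conjcM.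
  rewrite (_ : mc h' * z = - md h' / 2); last by rewrite /z; field.
  by rewrite conjcM conjcN conjc_inv conjc_nat ed; field.
have [g [Gg _]] := cpt _ hX; have dg := SL2Zi_det (proj1 Gg).
have [[ga gb gc gd _] _] := Gg.
rewrite act_pt2 // mul2A; set P := g ** A.
have gP : gaussian2 P by apply: gaussian2M.
have dP : det2 P = det2 A by rewrite det2M dg mul1r.
rewrite [pt2 _]surjective_pairing pt2_height // dP -/d => -[_ /andP [lo hi]].
(* With [mc P] = 0 the height is at least t / d > r; otherwise it is at most d / t < eps. *)
have [c0|c0] := eqVneq (mc P) 0.
  have eP : ma P * md P = det2 A by rewrite -dP /det2 c0 mulr0 subr0.
  have aP0 : ma P != 0 by apply: contraNneq dA => e; rewrite -eP e mul0r.
  have dP0 : md P != 0 by apply: contraNneq dA => e; rewrite -eP e mulr0.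
  have le : sqn (md P) <= d ^+ 2.
    rewrite sqr_sqrtr ?sqn_ge0 // -eP sqnM ler_peMl ?sqn_ge0 //.
    by apply: gaussian_sqn_ge1 => //; case: gP.
  move: hi; rewrite c0 /sqn /= !(mul0r, add0r, expr0n, oppr0) -/(sqn (md P)).
  rewrite ler_pdivrMr ?sqn_gt0 // => hi.
  have : d * t <= `|r| * d ^+ 2.
    apply: le_trans hi _; apply: le_trans (_ : `|r| * sqn (md P) <= _).
      by rewrite ler_wpM2r ?sqn_ge0 ?ler_norm.
    by rewrite ler_wpM2l.
  by rewrite expr2 mulrA [_ * d]mulrC ler_pM2l // /t; lra.
have c1 : 1 <= sqn (mc P) by apply: gaussian_sqn_ge1 => //; case: gP.
have n0 : 0 < sqn (mc P) * t ^+ 2 + sqn (mc P * z + md P).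
  by rewrite ltr_wpDr ?sqn_ge0 // mulr_gt0 ?exprn_gt0 // (lt_le_trans ltr01).
move: lo; rewrite ler_pdivlMr // => lo.
have : eps * t ^+ 2 <= d * t.
  apply: le_trans lo; rewrite ler_pM2l // ler_wpDr ?sqn_ge0 //.
  by rewrite ler_peMl ?exprn_ge0 // ltW.
rewrite expr2 mulrA ler_pM2r // -ler_pdivlMl // mulrC /t; lra.
Qed.
End Cusps.

(** * Integral forms *)

Lemma nearest_multiple (a x : int) : a != 0 -> exists u, 4 * (x + a * u) ^+ 2 <= a ^+ 2.
Proof.
move=> a0; have := divz_eq x a; have := modz_ge0 x a0; have := ltz_mod x a0.
move: (modz x a) (divz x a) => r q r1 r0 ->.
have [h|h] : 2 * r <= `|a| \/ `|a| < 2 * r by lia.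
  by exists (- q); rewrite mulrN mulrC [q * a]mulrC addrAC subrr add0r; nia.
have [a1|a1] := ltrP 0 a.
  by exists (- q - 1); have -> : q * a + r + a * (- q - 1) = r - a by [ring]; nia.
by exists (- q + 1); have -> : q * a + r + a * (- q + 1) = r + a by [ring]; nia.
Qed.

Definition disc (a x y c : int) : int := x ^+ 2 + y ^+ 2 - a * c.

(** Infinite descent on |a|. Once B is reduced modulo a, |B|^2 and D both lie between 0 and a^2/2,
    hence so does |ac|, and the swap makes c, with |c| < |a|, the new leading coefficient. *)
Lemma reduction (P : int -> int -> int -> int -> Prop) :
  (forall a x y c u v, P a x y c ->
     P a (x + a * u) (y - a * v) (a * (u ^+ 2 + v ^+ 2) + 2 * (x * u - y * v) + c)) ->
  (forall a x y c, P a x y c -> P c (- x) y a) ->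
  (forall a x y c, P a x y c ->
     [/\ a != 0, 0 < disc a x y c & 2 * disc a x y c <= a ^+ 2]) ->
  forall a x y c, ~ P a x y c.
Proof.
move=> Ptr Psw Pd a; have [n] := ubnP `|a|%N; elim: n a => // n IH a lan x y c Pf.
have [a0 _ _] := Pd _ _ _ _ Pf.
have [u hu] := nearest_multiple x a0.
have [v hv] := nearest_multiple y a0.
(* Translation by u + iv adds a(u - iv) to B, whence the sign of v. *)
have := Ptr _ _ _ _ u (- v) Pf; rewrite mulrN opprK.
move: (x + a * u) (y + a * v) (_ + c) hu hv => x' y' c' hx hy Pf'.
have [_ D0 D2] := Pd _ _ _ _ Pf'; rewrite /disc in D0 D2.
apply: (IH c' _ _ _ _ (Psw _ _ _ _ Pf')).
have [_ _ _] := Pd _ _ _ _ (Psw _ _ _ _ Pf').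
have le : 2 * `|a * c'| <= a ^+ 2 by lia.
have lt : `|c'| < `|a| by rewrite normrM in le; nia.
lia.
Qed.

Section Forms.
Variable R : realType.
Local Notation K := R[i].
Local Notation M := (mat2 R).
Implicit Types (h A tau : M) (a x y c : int).

Definition gi x y : K := x%:~R +i* y%:~R.

Lemma giE x y : gi x y = x%:~R + 'i%C * y%:~R.
Proof. by rewrite [LHS]complexE /= !realC_int. Qed.

Lemma conj_gi x y : conjc (gi x y) = x%:~R - 'i%C * y%:~R.
Proof. by rewrite /gi /= -intrN -/(gi _ _) giE intrN mulrN. Qed.

Lemma ii : 'i%C * 'i%C = -1 :> K.
Proof. by rewrite -expr2 sqr_i. Qed.

Lemma gaussian_gi x y : gaussian (gi x y).
Proof. by exists x, y. Qed.

Lemma disc_gi a x y c : sqn (gi x y) - (a * c)%:~R = (disc a x y c)%:~R :> R.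
Proof. by rewrite /sqn /disc /= intrD intrN intrD !expr2 !intrM. Qed.

Lemma discC a x y c :
  (disc a x y c)%:~R = gi x y * conjc (gi x y) - a%:~R * c%:~R :> K.
Proof. by rewrite -realC_int -disc_gi realCD realCN sqnC realC_int intrM. Qed.

Lemma transl_form a x y c u v :
  star2 (transl (gi u v)) ** form a (gi x y) c ** transl (gi u v) =
  form a (gi (x + a * u) (y - a * v))
    (a * (u ^+ 2 + v ^+ 2) + 2 * (x * u - y * v) + c).
Proof.
have i2 := ii.
rewrite /star2 /transl /mul2 /form; cbn [ma mb mc md].
rewrite !conjc1 !conjc0 !conj_gi !giE.
rewrite !(intrD, intrN, intrM, expr2).
by congr Mat2; ring: i2.
Qed.

Definition flip : M := Mat2 0 (-1) 1 0.

Lemma flip_form a x y c :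
  star2 flip ** form a (gi x y) c ** flip = form c (gi (- x) y) a.
Proof.
rewrite /star2 /flip /mul2 /form; cbn [ma mb mc md].
rewrite !conjcN !conjc1 !conjc0 !conj_gi !giE !intrN.
by congr Mat2; ring.
Qed.

Lemma anisotropic_transport A h h' (l : K) :
  star2 A ** h ** A = scal2 l ** h' -> gaussian2 A -> det2 A != 0 ->
  anisotropic h -> anisotropic h'.
Proof.
move=> e gA dA an A' gA' dA'.
have := an (A ** A') (gaussian2M gA gA'); rewrite det2M mulf_neq0 // => /(_ isT).
rewrite (congruence_transport _ e); case: (_ ** A') => m ? ? ? /=.
by apply: contraNneq => ->; rewrite mulr0 mul0r addr0.
Qed.

Lemma anisotropic_neq0 a (B : K) c : anisotropic (form a B c) -> a != 0.
Proof.
move=> an; have := an (scal2 1); rewrite mulm1.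
have -> : star2 (scal2 1) = scal2 1 :> M by rewrite /star2 conjc1 conjc0.
rewrite mul1m /= intr_eq0; apply; first by split=> /=; auto.
by rewrite /det2 /= !mulr1 mulr0 subr0 oner_neq0.
Qed.

Lemma anisotropic_disc a x y c : anisotropic (form a (gi x y) c) ->
  forall d : int, d * d <> disc a x y c.
Proof.
move=> an d hd; have a0 := anisotropic_neq0 an.
have dC := discC a x y c; rewrite -hd intrM in dC.
(* Since a h(v) = |a v1 + conj(B) v2|^2 - D |v2|^2, the vector (d - conj(B), a) is isotropic when D
   = d^2; the second column only makes the determinant a. *)
pose A : M := Mat2 (d%:~R - conjc (gi x y)) (-1) a%:~R 0.
have gA : gaussian2 A.
  by have := gaussian_gi x y; split; cbn [A ma mb mc md]; auto 6.
have dA : det2 A != 0 by rewrite /det2 /= mulr0 mulN1r sub0r opprK intr_eq0.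
apply/negP: (an A gA dA); rewrite negbK.
rewrite /A /star2 /mul2 /form; cbn [ma mb mc md].
rewrite conjcD conjcN conjcK !conjc_int.
have e (B C : K) : d%:~R * d%:~R = B * C - a%:~R * c%:~R ->
  ((d%:~R - B) * a%:~R + a%:~R * B) * (d%:~R - C) +
  ((d%:~R - B) * C + a%:~R * c%:~R) * a%:~R = 0.
  by move=> e; ring: e.
by rewrite e.
Qed.

(** If tau = e + nu Q, then A tau A^-1 = e + nu (A Q A^-1), and the quotients are the entries of A Q
    [adj2 A]. *)
Lemma Gamma1_conj (nu : K) A tau : SL2Zi A -> Gamma1 nu tau ->
  Gamma1 nu (A ** tau ** adj2 A).
Proof.
move=> SA [St eSt]; have D1 : det2 (A ** tau ** adj2 A) = 1.
  by rewrite !det2M (SL2Zi_det SA) (SL2Zi_det St) !mul1r -(SL2Zi_det SA) /det2 /=; ring.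
move: SA (conj St eSt) D1.
case: A tau {St eSt} => [a b c d] [t1 t2 t3 t4] [/= ga gb gc gd dA].
have {}dA : a * d = 1 + b * c by rewrite -dA; ring.
case=> [[/= g1 g2 g3 g4 dt]] [e [he [/= [q1 gq1 e1] [q2 gq2 e2] [q3 gq3 e3] [q4 gq4 e4]]]].
have {}e1 : t1 = e + nu * q1 by rewrite -e1; ring.
have {}e4 : t4 = e + nu * q4 by rewrite -e4; ring.
move=> D1; split; first by split => //=; auto 6.
exists e; split => //=; split.
- exists ((a * q1 + b * q3) * d - (a * q2 + b * q4) * c); auto 10.
  by rewrite e1 e2 e3 e4; ring: dA.
- exists (- (a * q1 + b * q3) * b + (a * q2 + b * q4) * a); auto 10.
  by rewrite e1 e2 e3 e4; ring.
- exists ((c * q1 + d * q3) * d - (c * q2 + d * q4) * c); auto 10.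
  by rewrite e1 e2 e3 e4; ring.
- exists (- (c * q1 + d * q3) * b + (c * q2 + d * q4) * a); auto 10.
  by rewrite e1 e2 e3 e4; ring: dA.
Qed.
End Forms.

(** * Forms embedded at a given level: the ramified prime and the isogeny *)

Section Lattice.
Variable R : realType.
Local Notation K := R[i].
Local Notation M := (mat2 R).
Implicit Types (h A tau : M) (a x y c : int).

Lemma emb_SL2Zi (nu : K) A h h' : SL2Zi A -> star2 A ** h ** A = h' ->
  emb nu h -> emb nu h'.
Proof.
move=> SA e; apply: (@emb_transport _ A h h' 1 nu nu).
- by rewrite mul1m.
- exact: oner_neq0.
- by rewrite SL2Zi_det // oner_neq0.
- move=> tau Gt; exists (A ** tau ** adj2 A); first exact: Gamma1_conj.
  by rewrite -mul2A adj2_mul SL2Zi_det // mulm1.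
Qed.

Lemma SL2Zi_gaussian2 A : SL2Zi A -> gaussian2 A.
Proof. by case. Qed.

Lemma anisotropic_SL2Zi A h h' : SL2Zi A -> star2 A ** h ** A = h' ->
  anisotropic h -> anisotropic h'.
Proof.
move=> SA e; apply: (@anisotropic_transport _ A _ _ 1); first by rewrite mul1m.
  exact: SL2Zi_gaussian2.
by rewrite SL2Zi_det // oner_neq0.
Qed.

Lemma transl_SL2Zi (w : K) : gaussian w -> SL2Zi (transl w).
Proof. by move=> gw; split=> //=; auto; ring. Qed.

Lemma flip_SL2Zi : SL2Zi (flip R).
Proof. by split=> //=; auto; ring. Qed.

(** The hypotheses carried through the descent; they are invariant under SL_2(Z[i]). *)
Definition good (nu : K) a x y c : Prop :=
  [/\ emb nu (form a (gi R x y) c), anisotropic (form a (gi R x y) c) & 0 < disc a x y c].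

Lemma disc_transl a x y c u v :
  disc a (x + a * u) (y - a * v) (a * (u ^+ 2 + v ^+ 2) + 2 * (x * u - y * v) + c) =
  disc a x y c.
Proof. by rewrite /disc; ring. Qed.

Lemma disc_flip a x y c : disc c (- x) y a = disc a x y c.
Proof. by rewrite /disc; ring. Qed.

Lemma good_transl nu a x y c u v : good nu a x y c ->
  good nu a (x + a * u) (y - a * v) (a * (u ^+ 2 + v ^+ 2) + 2 * (x * u - y * v) + c).
Proof.
move=> [E an D0]; have St := transl_SL2Zi (gaussian_gi R u v).
have e := transl_form R a x y c u v.
split; [exact: emb_SL2Zi St e E | exact: anisotropic_SL2Zi St e an | by rewrite disc_transl].
Qed.

Lemma good_flip nu a x y c : good nu a x y c -> good nu c (- x) y a.
Proof.
move=> [E an D0]; have e := flip_form R a x y c.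
split; last by rewrite disc_flip.
  exact: emb_SL2Zi flip_SL2Zi e E.
exact: anisotropic_SL2Zi flip_SL2Zi e an.
Qed.

Lemma good_neq0 nu a x y c : good nu a x y c -> a != 0.
Proof. by case=> _ /anisotropic_neq0. Qed.

(** sigma fixes the plane, so the product moves it as the translation by w does; only the product
    has to lie in the congruence subgroup, not the translation itself. *)
Lemma good_crossing nu a x y c (w : int * int) sigma :
  good nu a x y c -> SL2Zi sigma ->
  star2 sigma ** form a (gi R x y) c ** sigma = form a (gi R x y) c ->
  Gamma1 nu (transl (gi R w.1 w.2) ** sigma) -> w != 0 ->
  4 * disc a x y c <= (w.1 ^+ 2 + w.2 ^+ 2) * a ^+ 2.
Proof.
move=> g Ss es /(let: And3 E _ _ := g in E) sep w0; rewrite leNgt; apply/negP => lt.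
have ds : det2 sigma != 0 by rewrite SL2Zi_det // oner_neq0.
have [_ _ D0] := g.
have W0 : gi R w.1 w.2 != 0.
  apply: contraNneq w0 => /eqP; rewrite eq_complex /= !intr_eq0 => /andP [/eqP e1 /eqP e2].
  by rewrite [w]surjective_pairing e1 e2.
apply: (crossing (good_neq0 g) _ W0 _ ds es) sep.
  by rewrite disc_gi ltr0z.
rewrite disc_gi /sqn /= !expr2 -!intrM -intrD -intrM -(intrM _ 4) ltr_int.
by rewrite -!expr2.
Qed.

(** Here w = 1 + i lies in the ideal and |w|^2 = 2, so the crossing bound is exactly 2 D <= a^2. *)
Lemma no_good_ramified a x y c : ~ good (gi R 1 1) a x y c.
Proof.
apply: (@reduction (good (gi R 1 1))) => {a x y c}.
- by move=> *; apply: good_transl.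
- by move=> *; apply: good_flip.
move=> a x y c g; split; [exact: good_neq0 g | by case: g |].
have S1 : SL2Zi (scal2 (1 : K)) by split=> //=; auto; ring.
have e1 : star2 (scal2 1) ** form a (gi R x y) c ** scal2 1 = form a (gi R x y) c.
  by rewrite mulm1 /star2 conjc1 conjc0 mul1m.
have := good_crossing (w := (1, 1)) g S1 e1.
rewrite mulm1 /= => /(_ _ isT) H; suff : Gamma1 (gi R 1 1) (transl (gi R 1 1)).
  by move=> /H; lia.
split; first exact/transl_SL2Zi/gaussian_gi.
exists 1; split; first by left.
by split=> /=; [exists 0 | exists 1 | exists 0 | exists 0]; auto; ring.
Qed.

Lemma gdvd0 (nu : K) : gdvd nu 0. Proof. by exists 0; auto; rewrite mulr0. Qed.

Lemma gdvdD (nu z w : K) : gdvd nu z -> gdvd nu w -> gdvd nu (z + w).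
Proof. by move=> [q gq ->] [r gr ->]; exists (q + r); auto; ring. Qed.

Lemma gdvdN (nu z : K) : gdvd nu z -> gdvd nu (- z).
Proof. by move=> [q gq ->]; exists (- q); auto; ring. Qed.

Lemma gdvdMl (nu z w : K) : gdvd nu z -> gaussian w -> gdvd nu (w * z).
Proof. by move=> [q gq ->] gw; exists (w * q); auto; ring. Qed.

Lemma gdvdMr (nu z w : K) : gdvd nu z -> gaussian w -> gdvd nu (z * w).
Proof. by move=> [q gq ->] gw; exists (q * w); auto; ring. Qed.

(** For A = diag(1, pi), A^* h A = p h'. Conjugation by A divides the upper right entry by pi and
    multiplies the lower left one by pi, so it takes level m + 1 into level m. *)
Lemma good_isogeny (pi : K) m (p : nat) a x y c x' y' :
  gaussian pi -> pi * conjc pi = (p%:R : R)%:C -> (0 < p)%N ->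
  gi R x y = pi * gi R x' y' ->
  good (pi ^+ m) (p%:Z * a) x y c -> good (pi ^+ m.+1) a x' y' c.
Proof.
move=> gp; rewrite realC_nat => ep p0 eB [E an D0].
have pC0 : p%:R != 0 :> K by rewrite pnatr_eq0 -lt0n.
have pi0 : pi != 0 by apply: contraNneq pC0 => e; rewrite -ep e mul0r.
pose A : M := Mat2 1 0 0 pi.
have dA : det2 A != 0 by rewrite /det2 /= mul1r mul0r subr0.
have gA : gaussian2 A by split => /=; auto.
have e : star2 A ** form (p%:Z * a) (gi R x y) c ** A = scal2 p%:R ** form a (gi R x' y') c.
  rewrite eB /star2 /A /form /mul2; cbn [ma mb mc md]; rewrite !conjcM conjc0 conjc1 -ep.
  rewrite intrM -[(Posz p)%:~R]/(p%:R) -ep /=.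
  by congr Mat2; ring.
split.
- apply: emb_transport e pC0 dA _ E => tau' [[g1 g2 g3 g4 dt] [s [hs [d1 [q gq e2] d3 d4]]]].
  exists (Mat2 (ma tau') (pi ^+ m * q) (pi * mc tau') (md tau')).
    split; first by split => /=; auto; rewrite -dt e2 exprS; ring.
    exists s; split=> //; rewrite exprSr in d1 d3 d4.
    have low z : gdvd (pi ^+ m * pi) z -> gdvd (pi ^+ m) z.
      by case=> r gr ->; exists (pi * r); auto; rewrite mulrA.
    split => /=; [exact: low | by exists q | apply: gdvdMl; auto; exact: low | exact: low].
  by case: tau' e2 {g1 g2 g3 g4 dt d1 d3 d4} => ? ? ? ? /= ->; congr Mat2 => /=;
    rewrite ?exprS; ring.
- exact: anisotropic_transport e gA dA an.
have DC := discC R (p%:Z * a) x y c; have DC' := discC R a x' y' c.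
have eD : (disc (p%:Z * a) x y c)%:~R = (p%:Z * disc a x' y' c)%:~R :> K.
  rewrite DC [RHS]intrM DC' eB conjcM intrM -[(Posz p)%:~R]/(p%:R) -ep; ring.
by move: D0; rewrite (intr_inj eD) pmulr_rgt0.
Qed.
End Lattice.

(** * Split primes *)

Section Split.
Variables (R : realType) (pi : R[i]) (p : nat).
Local Notation K := R[i].
Local Notation M := (mat2 R).
Hypothesis gpi : gaussian pi.
Hypothesis p_pr : prime p.
Hypothesis npi : pi * conjc pi = (p%:R : R)%:C.
Hypothesis split_pi : ~ gdvd pi (conjc pi).

Let npiZ : pi * conjc pi = (p%:Z)%:~R.
Proof. by rewrite npi realC_nat. Qed.

Lemma Euclid_dvdzM (m n : int) : (p %| m * n)%Z -> (p %| m)%Z \/ (p %| n)%Z.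
Proof. by rewrite !dvdzE /= abszM Euclid_dvdM // => /orP. Qed.

Lemma inverse_modp (n : int) : ~~ (p %| n)%Z -> exists b : int, (p %| n * b - 1)%Z.
Proof.
move=> ndv; have cop : coprimez n p.
  by rewrite coprimezE coprime_sym prime_coprime // -dvdzE.
have [u [v e]] := Bezoutz n p.
exists u; rewrite (eqP cop) in e.
by apply/dvdzP; exists (- v); rewrite -e; ring.
Qed.

Lemma gdvd_int (n : int) : gdvd pi n%:~R <-> (p %| n)%Z.
Proof.
split=> [[q [x [y eq]] e]|/dvdzP [k ->]]; last first.
  by exists (conjc pi * k%:~R); auto; rewrite intrM -npiZ; ring.
have : (p %| n * n)%Z.
  apply/dvdzP; exists (x * x + y * y); apply: (@intr_inj K).
  have eqq : q * conjc q = (x * x + y * y)%:~R.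
    by rewrite -sqnC eq /sqn /= !expr2 -!intrM -intrD realC_int.
  by rewrite intrM -{2}conjc_int e conjcM mulrACA npiZ eqq [RHS]intrM mulrC.
by case/Euclid_dvdzM.
Qed.

(** With pi = al + i be, be is invertible modulo p, as p | be would give p | al and p^2 | p. Thus i
    is congruent to -al/be, and Z maps onto Z[i]/(pi). *)
Lemma residue (z : K) : gaussian z -> exists n : int, gdvd pi (z - n%:~R).
Proof.
have [al [be epi]] := gpi.
have epi' : pi = al%:~R + 'i%C * be%:~R by rewrite epi -giE.
have e : al * al + be * be = p.
  apply: (@intr_inj K); rewrite -npiZ -sqnC epi /sqn /= !expr2 -!intrM -intrD.
  by rewrite realC_int.
have nbe : ~~ (p %| be)%Z.
  apply/negP => dbe; have dal : (p %| al)%Z.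
    suff : (p %| al * al)%Z by case/Euclid_dvdzM.
    have -> : al * al = p%:Z - be * be by rewrite -e addrK.
    by rewrite rpredB // dvdz_mulr.
  have : (p%:Z * p%:Z %| p%:Z)%Z by rewrite -[X in (_ %| X)%Z]e rpredD // dvdz_mul.
  rewrite -[X in (_ %| X)%Z]mulr1 dvdz_mul2l ?eqz_nat -?lt0n ?prime_gt0 // dvdz1.
  by move/eqP => p1; have := prime_gt1 p_pr; rewrite -[p]/(absz p) p1.
have [b /dvdzP [k hk]] := inverse_modp nbe.
move=> [x [y ->]]; exists (x - al * b * y).
exists (b%:~R * y%:~R - conjc pi * k%:~R * y%:~R * 'i%C).
  have gi1 : gaussian ('i%C : K) by exists 0, 1.
  by auto 10.
have hk' : be%:~R * b%:~R = 1 + k%:~R * p%:Z%:~R :> K.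
  by rewrite -[_ * b%:~R]intrM -[k%:~R * _]intrM -hk intrB; ring.
rewrite mulrBr !mulrA npiZ -/(gi R x y) giE {1}epi' intrB !intrM.
by ring: hk'.
Qed.

Lemma gdvd_prime (z w : K) : gaussian z -> gaussian w -> gdvd pi (z * w) ->
  gdvd pi z \/ gdvd pi w.
Proof.
move=> gz gw d; have [n dn] := residue gz; have [m dm] := residue gw.
have : gdvd pi (n * m)%:~R.
  have -> : (n * m)%:~R = z * w + - ((z - n%:~R) * w) + - (n%:~R * (w - m%:~R)) :> K.
    by rewrite intrM; ring.
  by apply: gdvdD; [apply: gdvdD => // |]; apply: gdvdN; [apply: gdvdMr | apply: gdvdMl].
move/gdvd_int/Euclid_dvdzM => [/gdvd_int h|/gdvd_int h]; [left|right].
  by have := gdvdD dn h; rewrite subrK.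
by have := gdvdD dm h; rewrite subrK.
Qed.

Lemma gdvd_pX (z : K) n : gaussian z -> gdvd pi (z ^+ n) -> gdvd pi z.
Proof.
move=> gz; elim: n => [|n IH]; last by rewrite exprS => /gdvd_prime [] //; auto.
rewrite expr0 => /(gdvd_int 1); rewrite dvdz1 => /eqP e1.
by have := prime_gt1 p_pr; rewrite -[p]/(absz p) e1.
Qed.

(** The solution is taken as a natural number because it later enters an exponent. *)
Lemma solve_linear (e v : K) : gaussian e -> gaussian v -> ~ gdvd pi v ->
  exists j : nat, gdvd pi (e + j%:R * v).
Proof.
move=> ge gv nv; have [E dE] := residue ge; have [V dV] := residue gv.
have nV : ~~ (p %| V)%Z.
  by apply/negP => /gdvd_int h; apply: nv; have := gdvdD dV h; rewrite subrK.
have [b hb] := inverse_modp nV.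
have p0 : p != 0 :> int by rewrite eqz_nat -lt0n prime_gt0.
have := modz_ge0 (- E * b) p0; case ej : (modz _ _) => [j|//] _; exists j.
have h : gdvd pi (E + j%:Z * V)%:~R.
  apply/gdvd_int; rewrite -ej /modz.
  have -> : E + (- E * b - divz (- E * b) p * p) * V =
            - E * (V * b - 1) - divz (- E * b) p * V * p by ring.
  by rewrite rpredB // dvdz_mull.
have -> : e + j%:R * v = (e - E%:~R) + j%:R * (v - V%:~R) + (E + j%:Z * V)%:~R.
  by rewrite intrD intrM; ring.
apply: gdvdD => //; apply: gdvdD => //; apply: gdvdMl => //; exact: (gaussian_int R j).
Qed.

(** Hensel lifting: k is corrected by p^m j = pi^m conj(pi)^m j, where conj(pi) is prime to pi
    because p splits. *)
Lemma inverse_modpiX (u : K) m : gaussian u -> ~ gdvd pi u ->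
  exists k : nat, gdvd (pi ^+ m) (k%:R * u - 1).
Proof.
move=> gu nu; elim: m => [|m [k [e ge hk]]].
  by exists 0%N, (0 * u - 1); [auto | rewrite expr0 mul1r].
have gcX : gaussian (conjc pi ^+ m * u) by auto.
have [|j [q gq hj]] := solve_linear ge gcX.
  by case/gdvd_prime; auto => /gdvd_pX h; apply/split_pi/h; auto.
exists (k + p ^ m * j)%N, q => //.
have pm : p%:R ^+ m = pi ^+ m * conjc pi ^+ m :> K by rewrite -exprMn npi realC_nat.
have -> : (k + p ^ m * j)%:R * u - 1 = pi ^+ m * (e + j%:R * (conjc pi ^+ m * u)).
  by rewrite natrD natrM natrX pm mulrDr -hk; ring.
by rewrite hj exprSr mulrA.
Qed.

(** * Unipotents modulo pi^m in the stabilizer *)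

Lemma p_part (n : int) : n != 0 -> exists f (m : int), n = p%:Z ^+ f * m /\ ~~ (p %| m)%Z.
Proof.
have [k] := ubnP `|n|%N; elim: k n => // k IH n nk n0.
have [/dvdzP [q eq]|nd] := boolP (p %| n)%Z; last first.
  by exists 0%N, n; rewrite mul1r.
have q0 : q != 0 by apply: contraNneq n0 => e; rewrite eq e mul0r.
have [|f [m [eqm nm]]] := IH q _ q0.
  have := prime_gt1 p_pr; rewrite eq abszM /= in nk; nia.
by exists f.+1, m; rewrite eq {1}eqm exprS; split => //; ring.
Qed.

(** From x^2 - N z^2 = 1 with N = D (a p^m)^2, squaring x + z sqrt N gives X = 2 x^2 - 1, which is 1
    modulo p^m, where x is only known to square to 1; Z is the part of 2 x z prime to p. *)
Lemma pell_p (D a : int) m : 0 < D -> (forall d : int, d * d <> D) -> a != 0 ->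
  exists (X Z : int) n, [/\ (p%:Z ^+ m %| X - 1)%Z, ~~ (p %| Z)%Z, (m <= n)%N
    & X ^+ 2 - D * a ^+ 2 * (p%:Z ^+ n * Z) ^+ 2 = 1].
Proof.
move=> D0 nsq a0; have p0 : p%:Z != 0 by rewrite eqz_nat -lt0n prime_gt0.
have pm0 : p%:Z ^+ m != 0 by rewrite expf_neq0.
pose N := D * (a * p%:Z ^+ m) ^+ 2.
have N0 : 0 < N by rewrite mulr_gt0 // exprn_even_gt0 // mulf_neq0.
have [|x [z [z0 e]]] := pell N0.
  move=> d hd; have dv : (a * p%:Z ^+ m %| d)%Z.
    by rewrite -(dvdz_pexp2r _ _ (isT : (0 < 2)%N)) [d ^+ 2]expr2 hd dvdz_mull.
  case/dvdzP: dv hd => k ->; rewrite /N => hd; apply: (nsq k).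
  apply: (mulIf (_ : (a * p%:Z ^+ m) ^+ 2 != 0)); first by rewrite sqrf_eq0 mulf_neq0.
  by rewrite -hd; ring.
have x0 : x != 0 by apply: contraPneq e => ->; move: N0; nia.
have [f [Z [eZ nZ]]] := p_part (mulf_neq0 (mulf_neq0 (isT : 2 != 0 :> int) x0) (introN eqP z0)).
have e' : x ^+ 2 = 1 + D * a ^+ 2 * p%:Z ^+ m ^+ 2 * z ^+ 2.
  by move: e; rewrite /N => <-; ring.
exists (2 * x ^+ 2 - 1), Z, (m + f)%N; split=> //; last 2 first.
- exact: leq_addr.
- have -> : p%:Z ^+ (m + f) * Z = p%:Z ^+ m * (2 * x * z) by rewrite exprD -mulrA -eZ.
  transitivity ((2 * x ^+ 2 - 1) ^+ 2 - 4 * x ^+ 2 * (D * a ^+ 2 * p%:Z ^+ m ^+ 2 * z ^+ 2)).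
    by ring.
  by rewrite -(addKr 1 (_ * z ^+ 2)) -e'; ring.
apply/dvdzP; exists (2 * D * a ^+ 2 * p%:Z ^+ m * z ^+ 2).
by rewrite e'; ring.
Qed.

Definition pow2 (g : M) k : M := iter k (mul2 g) (scal2 1).

Lemma pow2_SL2Zi g k : SL2Zi g -> SL2Zi (pow2 g k).
Proof.
move=> Sg; elim: k => [|k IH]; first by split=> //=; auto; ring.
have [g1 g2 g3 g4] := gaussian2M (SL2Zi_gaussian2 Sg) (SL2Zi_gaussian2 IH).
by split=> //; have := det2M g (pow2 g k); rewrite (SL2Zi_det Sg) (SL2Zi_det IH) mul1r.
Qed.

Lemma pow2_form g h k : star2 g ** h ** g = h -> star2 (pow2 g k) ** h ** pow2 g k = h.
Proof.
move=> e; elim: k => [|k IH].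
  by rewrite /= mulm1 /star2 conjc1 conjc0 mul1m.
by rewrite /= star2M -!mul2A (mul2A h) (mul2A (star2 g)) (mul2A (star2 g) h) e mul2A.
Qed.

Lemma pow2_unipotent (nu s : K) g k : SL2Zi g -> gaussian s ->
  [/\ gdvd nu (ma g - 1), gdvd nu (mb g - s), gdvd nu (mc g) & gdvd nu (md g - 1)] ->
  [/\ gdvd nu (ma (pow2 g k) - 1), gdvd nu (mb (pow2 g k) - k%:R * s),
      gdvd nu (mc (pow2 g k)) & gdvd nu (md (pow2 g k) - 1)].
Proof.
move=> Sg gs [d1 d2 d3 d4]; elim: k => [|k [h1 h2 h3 h4]].
  by rewrite /= mul0r !subrr; split; apply: gdvd0.
have [a1 a2 a3 a4 _] := Sg; have [b1 b2 b3 b4 _] := pow2_SL2Zi k Sg.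
rewrite /= -/(pow2 g k); set G := pow2 g k in h1 h2 h3 h4 b1 b2 b3 b4 *.
split.
- have -> : ma g * ma G + mb g * mc G - 1 = (ma g - 1) * ma G + mb g * mc G + (ma G - 1).
    by ring.
  by apply: gdvdD => //; apply: gdvdD; [apply: gdvdMr | apply: gdvdMl].
- have -> : ma g * mb G + mb g * md G - k.+1%:R * s =
     (ma g - 1) * mb G + mb g * (md G - 1) + (mb G - k%:R * s) + (mb g - s).
    by rewrite -natr1; ring.
  apply: gdvdD => //; apply: gdvdD => //.
  by apply: gdvdD; [apply: gdvdMr | apply: gdvdMl].
- by apply: gdvdD; [apply: gdvdMr | apply: gdvdMl].
have -> : mc g * mb G + md g * md G - 1 = mc g * mb G + (md g - 1) * md G + (md G - 1).
  by ring.
by apply: gdvdD => //; apply: gdvdD; apply: gdvdMr.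
Qed.

(** X is 1 and mu is 0 modulo pi^m, so g reduces to (1, s; 0, 1) with s = D conj(mu), which pi does
    not divide: conj(mu) is a power of conj(pi) times Z. *)
Lemma stabilizer_unipotent (a x y c : int) m :
  a != 0 -> 0 < disc a x y c -> (forall d : int, d * d <> disc a x y c) ->
  ~~ (p %| disc a x y c)%Z ->
  exists g (s : K),
    [/\ SL2Zi g, star2 g ** form a (gi R x y) c ** g = form a (gi R x y) c,
        gaussian s, ~ gdvd pi s
      & [/\ gdvd (pi ^+ m) (ma g - 1), gdvd (pi ^+ m) (mb g - s),
            gdvd (pi ^+ m) (mc g) & gdvd (pi ^+ m) (md g - 1)]].
Proof.
set D := disc a x y c => a0 D0 nsq npD.
have [X [Z [n [dX nZ mn eX]]]] := pell_p m D0 nsq a0.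
have gB := gaussian_gi R x y; set B := gi R x y in gB *.
pose mu : K := pi ^+ (n + n) * Z%:~R.
pose mu' : K := conjc pi ^+ (n + n) * Z%:~R.
have cmu : conjc mu = mu' by rewrite /mu conjcM conjcX conjc_int.
have cmu' : conjc mu' = mu by rewrite -cmu conjcK.
have gmu : gaussian mu by rewrite /mu; auto.
have gmu' : gaussian mu' by rewrite /mu'; auto.
have DC : D%:~R = B * conjc B - a%:~R * c%:~R := discC R a x y c.
have nmu : mu * mu' = ((p%:Z ^+ n * Z) ^+ 2)%:~R.
  rewrite /mu /mu' mulrACA -exprMn npiZ -intrM exprD rmorphXn /= !rmorphM !rmorphXn /=.
  by ring.
have dmu : gdvd (pi ^+ m) mu.
  exists (pi ^+ (n - m + n) * Z%:~R); first by auto.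
  by rewrite mulrA -exprD addnA subnKC.
have nZ' : ~ gdvd pi Z%:~R by move/gdvd_int; apply/negP.
have ndmu' : ~ gdvd pi mu'.
  case/gdvd_prime; auto.
  by move/gdvd_pX => h; apply/split_pi/h; auto.
clearbody mu mu'.
have eXC : X%:~R * X%:~R =
    1 + (B * conjc B - a%:~R * c%:~R) * a%:~R * a%:~R * (mu * mu').
  rewrite nmu -DC -!intrM -[1]/(1%:~R) -intrD.
  by congr (_%:~R); rewrite -eX; ring.
pose g := Mat2 (X%:~R - a%:~R * conjc B * mu) (mu' * D%:~R - conjc B ^+ 2 * mu)
               (a%:~R ^+ 2 * mu) (X%:~R + a%:~R * conjc B * mu).
have dX1 : gdvd (pi ^+ m) (X%:~R - 1).
  case/dvdzP: dX => k ek; exists (conjc pi ^+ m * k%:~R); first by auto.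
  by rewrite mulrA -exprMn npiZ -rmorphXn /= mulrC -intrM -ek intrB.
have nD : ~ gdvd pi D%:~R by move/gdvd_int; apply/negP.
exists g, (mu' * D%:~R); split.
- split; cbn [g ma mb mc md]; auto 8.
  rewrite DC; transitivity (X%:~R * X%:~R -
    (B * conjc B - a%:~R * c%:~R) * a%:~R * a%:~R * (mu * mu')); first by ring.
  by rewrite eXC; ring.
- rewrite /g /star2 /mul2 /form; cbn [ma mb mc md].
  rewrite !(conjcD, conjcN, conjcM, conjcX, conjc_int, conjcK) cmu cmu' DC.
  by congr Mat2; ring: eXC.
- by auto.
- by case/gdvd_prime; auto.
cbn [g ma mb mc md]; split.
- rewrite addrAC; apply: gdvdD => //; apply: gdvdN; apply: gdvdMl; auto.
- by rewrite addrAC subrr add0r; apply: gdvdN; apply: gdvdMl; auto.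
- by apply: gdvdMl; auto.
- by rewrite addrAC; apply: gdvdD => //; apply: gdvdMl; auto.
Qed.

(** A power of the unipotent has upper right entry 1 modulo pi^m; composing with the translation by
    -1 gives an element of the congruence subgroup. Hence w = -1 and 4 D <= a^2, more than the
    descent asks. *)
Lemma no_good_coprime m (a x y c : int) :
  good (pi ^+ m) a x y c -> ~ ~~ (p %| disc a x y c)%Z.
Proof.
move=> g0 n0.
apply: (@reduction (fun a x y c => good (pi ^+ m) a x y c /\ ~~ (p %| disc a x y c)%Z)
   _ _ _ a x y c) => // {a x y c g0 n0}.
- by move=> a x y c u v [g nd]; rewrite disc_transl; split=> //; apply: good_transl.
- by move=> a x y c [g nd]; rewrite disc_flip; split=> //; apply: good_flip.
move=> a x y c [g nd]; have a0 := good_neq0 g; have [_ an D0] := g.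
split=> //.
have [s [u [Ss es gu nu du]]] := stabilizer_unipotent m a0 D0 (anisotropic_disc an) nd.
have [k hk] := inverse_modpiX m gu nu.
have [h1 h2 h3 h4] := pow2_unipotent k Ss gu du.
have Sk := pow2_SL2Zi k Ss; have ek := pow2_form k es.
have [b1 b2 b3 b4 dk] := Sk.
suff : Gamma1 (pi ^+ m) (transl (gi R (-1) 0) ** pow2 s k).
  move=> Gk; have := good_crossing (w := (-1, 0)) g Sk ek Gk isT.
  by rewrite /=; lia.
have eg : gi R (-1) 0 = -1 by rewrite giE; ring.
rewrite eg; split.
  split; rewrite /= ?mul1r ?mul0r ?add0r; auto.
  by rewrite -dk; ring.
exists 1; split; first by left.
split; cbn [transl mul2 ma mb mc md]; rewrite ?mul1r ?mul0r ?add0r //.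
- by rewrite addrAC; apply: gdvdD => //; apply: gdvdMl; auto.
have -> : mb (pow2 s k) + -1 * md (pow2 s k) =
  (mb (pow2 s k) - k%:R * u) + (k%:R * u - 1) - (md (pow2 s k) - 1) by ring.
by apply: gdvdD; [apply: gdvdD | apply: gdvdN].
Qed.

(** Induction on D, with the level m free as each isogeny raises it. When p | D, an equivalent form
    with p | a and pi | B is sought, to which the isogeny applies. *)
Lemma no_good_split m (a x y c : int) : ~ good (pi ^+ m) a x y c.
Proof.
have [n] := ubnP `|disc a x y c|%N; elim: n m a x y c => // n IH m a x y c lt g.
have [dD|] := boolP (p %| disc a x y c)%Z; last exact: no_good_coprime g.
(* By induction no form of this discriminant, good at this level, has p | a and pi | B. *)
have step a' x' y' c' : disc a' x' y' c' = disc a x y c ->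
    good (pi ^+ m) a' x' y' c' -> (p %| a')%Z -> ~ gdvd pi (gi R x' y').
  move=> eD g' /dvdzP [a1 ea] [_ [x1 [y1 ->]] eB].
  have {}eB : gi R x' y' = pi * gi R x1 y1 := eB.
  rewrite ea mulrC in g'; have g1 := good_isogeny gpi npi (prime_gt0 p_pr) eB g'.
  apply: (IH _ _ _ _ _ _ g1).
  have eD1 : disc a x y c = p%:Z * disc a1 x1 y1 c'.
    apply: (@intr_inj K). rewrite -eD ea [RHS]intrM !discC eB conjcM intrM -npiZ; ring.
  have [_ _ D1] := g1; rewrite eD1 abszM /= in lt.
  have := prime_gt1 p_pr; move: (disc _ _ _ _) D1 lt => d D1; nia.
(* If p does not divide a, translate B to 0 modulo p; then p | ac forces p | c, and the flip puts c
   in front. *)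
have [da|nda] := boolP (p %| a)%Z; last first.
  have [b hb] := inverse_modp nda.
  have g1 := good_transl (- b * x) (b * y) g.
  have eD := disc_transl a x y c (- b * x) (b * y).
  have dx : (p %| x + a * (- b * x))%Z.
    by rewrite (_ : _ + _ = - x * (a * b - 1)) ?dvdz_mull //; ring.
  have dy : (p %| y - a * (b * y))%Z.
    by rewrite (_ : _ - _ = - y * (a * b - 1)) ?dvdz_mull //; ring.
  move: (x + _) (y - _) (_ + c) dx dy eD g1 => x' y' c' dx dy eD g1.
  have dc : (p %| c')%Z.
    suff : (p %| a * c')%Z by case/Euclid_dvdzM => // h; rewrite h in nda.
    have -> : a * c' = x' * x' + y' * y' - disc a x y c by rewrite -eD /disc; ring.
    by rewrite rpredB // rpredD // dvdz_mulr.
  apply: (step c' (- x') y' a) dc _; [by rewrite disc_flip | exact: good_flip |].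
  rewrite giE; apply: gdvdD; first by apply/gdvd_int; rewrite rpredN.
  by apply: gdvdMl; [apply/gdvd_int | exists 0, 1].
have nB := step _ _ _ _ erefl g da.
have gB := gaussian_gi R x y.
have dC := discC R a x y c.
(* Now p | a, so p divides |B|^2 = D + ac, while pi does not divide B. *)
have dBc : gdvd pi (conjc (gi R x y)).
  have : gdvd pi (gi R x y * conjc (gi R x y)).
    have -> : gi R x y * conjc (gi R x y) = (disc a x y c + a * c)%:~R.
      by rewrite intrD dC intrM subrK.
    by apply/gdvd_int; rewrite rpredD // dvdz_mulr.
  by case/gdvd_prime; auto.
(* Translating by j makes c divisible by pi, hence by p; after the flip B becomes -conj(B + a j),
   which pi divides. *)
have [j hj] := solve_linear (gaussian_int R c) gB nB.
have g1 := good_transl j 0 g.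
apply: (step _ _ _ _ _ (good_flip g1)); first by rewrite disc_flip disc_transl.
  apply/gdvd_int.
  have -> : (a * (j%:Z ^+ 2 + 0 ^+ 2) + 2 * (x * j - y * 0) + c)%:~R =
    (c%:~R + j%:R * gi R x y) + conjc (gi R x y) * j%:R + a%:~R * (j%:R * j%:R).
    by rewrite conj_gi giE !(intrD, intrM, intrN, expr2) -[(Posz j)%:~R]/(j%:R); ring.
  apply: gdvdD; last by apply: gdvdMr;
    [apply/gdvd_int | apply: gaussianM; apply: (gaussian_int R j)].
  by apply: gdvdD => //; apply: gdvdMr => //; apply: (gaussian_int R j).
have -> : gi R (- (x + a * j)) (y - a * 0) = - (conjc (gi R x y) + a%:~R * j%:R).
  by rewrite conj_gi giE !(intrD, intrM, intrN) -[(Posz j)%:~R]/(j%:R); ring.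
apply: gdvdN; apply: gdvdD => //; apply: gdvdMr; [exact/gdvd_int | exact: (gaussian_int R j)].
Qed.
End Split.

Theorem theorem1p2 (R : realType) (pi : R[i]) :
  gaussian pi ->
  ((exists p : nat, prime p /\ pi * conjc pi = (p%:R : R)%:C /\ ~ gdvd pi (conjc pi))
   \/ pi = 1 +i* 1) ->
  ~ has_closed_embedded_tg_surface (Gamma1 pi).
Proof.
move=> gpi hpi [a [_ [c [[[x [y ->]] D0] [E cl]]]]].
have g : good pi a x y c.
  split; [exact: embedded_emb | exact: closed_anisotropic cl |].
  by move: D0; rewrite disc_gi ltr0z.
case: hpi => [[p [p_pr [npi spl]]]|epi].
  by apply: (@no_good_split _ _ _ gpi p_pr npi spl 1 a x y c); rewrite expr1.
by move: g; rewrite epi; apply: no_good_ramified.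
Qed.
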